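(* Assume that the generalized $d_a$-projection $\mathfrak{P}(\overline{\bm p}_{sa};\bm b,\beta)$ can be computed to any accuracy $\delta>0$ in time $\mathcal{O}(h(S,\delta))$. Then, for any $\bm v\in[0,\overline R]^S$, the robust Bellman iterate $\mathfrak{B}(\bm v)$ can be computed for all states $s\in\mathcal{S}$ to accuracy $\epsilon>0$, i.e., one can compute $\bm v'\in\mathbb{R}^S$ with $\lVert\bm v'-\mathfrak{B}(\bm v)\rVert_\infty\le\epsilon$, in time $$\mathcal{O}\big(A S\cdot h(S,\ \epsilon\kappa/[2A\overline R+A\epsilon])\cdot\log[\overline R/\epsilon]\big).$$
   Context: $\mathcal{S}=\{1,\dots,S\}$ and $\mathcal{A}=\{1,\dots,A\}$ are finite state and action spaces, $\Delta_n=\{\bm p\in\mathbb{R}^n_+:\mathbf{e}^\top\bm p=1\}$ is the probability simplex ($\mathbf{e}$ is the all-ones vector), $\bm r_{sa}=(r_{sas'})_{s'\in\mathcal{S}}\in\mathbb{R}^S_+$ are non-negative rewards, $\lambda\in(0,1)$ is a discount factor, and $\overline{\bm p}_{sa}\in\Delta_S$ are nominal transition probabilities. For each $s\in\mathcal{S}$, the ambiguity set is $$\mathcal{P}_s=\Big\{\bm p_s=(\bm p_{s1},\dots,\bm p_{sA})\in(\Delta_S)^A:\ \sum_{a\in\mathcal{A}}d_a(\bm p_{sa},\overline{\bm p}_{sa})\le\kappa\Big\},$$ where the deviation functions $d_a:\Delta_S\times\Delta_S\to\mathbb{R}$ are convex in their first argument for fixed second argument, non-negative, and satisfy $d_a(\bm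 p,\bm p')=0$ if and only if $\bm p=\bm p'$; the budget satisfies $\kappa>0$. The robust Bellman operator is defined by $$[\mathfrak{B}(\bm v)]_s=\max_{\bm\pi_s\in\Delta_A}\ \min_{\bm p_s\in\mathcal{P}_s}\ \sum_{a\in\mathcal{A}}\pi_{sa}\,\bm p_{sa}^\top(\bm r_{sa}+\lambda\bm v),\qquad s\in\mathcal{S}.$$ For $\bm b\in\mathbb{R}^S_+$ and $\beta\in\mathbb{R}_+$, the generalized $d_a$-projection is the optimal value $$\mathfrak{P}(\overline{\bm p}_{sa};\bm b,\beta)=\min\{d_a(\bm p_{sa},\overline{\bm p}_{sa}):\ \bm b^\top\bm p_{sa}\le\beta,\ \bm p_{sa}\in\Delta_S\},$$ which is feasible if and only if $\min_i b_i\le\beta$. It is solved to $\delta$-accuracy by any pair $(\underline d,\overline d)\in\mathbb{R}^2$ with $\mathfrak{P}(\overline{\bm p}_{sa};\bm b,\beta)\in[\underline d,\overline d]$ and $\overline d-\underline d\le\delta$. Finally, $\overline R=[1-\lambda]^{-1}\max\{r_{sas'}:s,s'\in\mathcal{S},a\in\mathcal{A}\}$. Time counts elementary arithmetic operations; evaluating $d_a$ is assumed to take time $\mathcal{O}(1)$ if one of its arguments is a Dirac distribution and $\mathcal{O}(S)$ otherwise.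
   Formalization: The factor log[R̄/ε] is read as max(1, ln(R̄/ε)), since the literal logarithm tends to 0 or is negative for ε near or above R̄, and running times include reading the input, so h(S,δ) is at least of order S. *)

(* Defs.v *)
(* World: MathComp with MathComp-Analysis, over an arbitrary [R : realType]. *)
From HB Require Import structures.
From mathcomp Require Import all_boot all_order all_algebra.
From mathcomp Require Import all_classical all_reals all_analysis.

Set Implicit Arguments.
Unset Strict Implicit.
Unset Printing Implicit Defensive.

Import Order.TTheory GRing.Theory Num.Theory.
Import numFieldNormedType.Exports.

Local Open Scope classical_set_scope.
Local Open Scope ring_scope.

(** * Robust Markov decision processes *)

Definition simplex (R : realType) (n : nat) : set 'rV[R]_n :=
  [set p | (forall i, 0 <= p 0 i) /\ \sum_i p 0 i = 1].
Arguments simplex {R} n.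

Definition dotv (R : realType) (n : nat) (p b : 'rV[R]_n) : R :=
  \sum_i p 0 i * b 0 i.

(* Only the values of [d] on pairs of probability vectors matter anywhere
   below; its values elsewhere are junk. *)
Definition deviation (R : realType) (S : nat)
    (d : 'rV[R]_S -> 'rV[R]_S -> R) : Prop :=
  [/\ forall q, simplex S q -> convex_function (simplex S) (d ^~ q),
      forall p q, simplex S p -> simplex S q -> 0 <= d p q &
      forall p q, simplex S p -> simplex S q -> (d p q = 0 <-> p = q)].

Record rmdp (R : realType) (S A : nat) := RMDP {
  reward : 'I_S -> 'I_A -> 'rV[R]_S;
  discount : R;
  nominal : 'I_S -> 'I_A -> 'rV[R]_S;
  budget : R }.

Definition valid_rmdp (R : realType) (S A : nat) (M : rmdp R S A) : Prop :=
  [/\ forall s a s', 0 <= reward M s a 0 s',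
      0 < discount M < 1,
      forall s a, simplex S (nominal M s a) &
      0 < budget M].

Definition ambiguity (R : realType) (S A : nat)
    (d : 'I_A -> 'rV[R]_S -> 'rV[R]_S -> R) (M : rmdp R S A) (s : 'I_S) :
    set ('I_A -> 'rV[R]_S) :=
  [set p | (forall a, simplex S (p a)) /\
           \sum_a d a (p a) (nominal M s a) <= budget M].

(* The extrema are written [sup] and [inf], over nonempty bounded sets of reals;
   they agree with max and min whenever these are attained.  Nothing forces
   attainment of the inner minimum: a convex [d a] need not be lower
   semicontinuous on the boundary of the simplex. *)
Definition bellman (R : realType) (S A : nat)
    (d : 'I_A -> 'rV[R]_S -> 'rV[R]_S -> R) (M : rmdp R S A)
    (v : 'rV[R]_S) : 'rV[R]_S :=
  \row_s sup
    [set inf [set \sum_a pi 0 a * dotv (p a) (reward M s a + discount M *: v)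
             | p in ambiguity d M s]
    | pi in simplex A].

(* Rewards are nonnegative, so 0 is a harmless seed for the maximum. *)
Definition Rbar (R : realType) (S A : nat) (M : rmdp R S A) : R :=
  (1 - discount M)^-1 *
  \big[Num.max/0]_(s < S) \big[Num.max/0]_(a < A) \big[Num.max/0]_(s' < S)
    reward M s a 0 s'.

(* As above, [inf] stands for the minimum. *)
Definition projection (R : realType) (S : nat)
    (d : 'rV[R]_S -> 'rV[R]_S -> R) (pbar b : 'rV[R]_S) (beta : R) : R :=
  inf [set d p pbar | p in [set p | simplex S p /\ dotv p b <= beta]].

Definition projection_accurate (R : realType) (S : nat)
    (d : 'rV[R]_S -> 'rV[R]_S -> R) (pbar b : 'rV[R]_S) (beta delta lo hi : R) :
    Prop :=
  lo <= projection d pbar b beta <= hi /\ hi - lo <= delta.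

(** * Real RAM

    A structured real RAM.  Natural-number registers hold sizes and indices;
    real numbers live in arrays (array [k], cell [i]).  Reals are only accessed
    through exact field operations and comparisons: there is no rounding and no
    conversion from reals to naturals, and the only real literals are naturals.
    Every operation costs one time unit, except for the evaluation of a
    deviation function and for calls, described with [exec].  Division by 0
    yields 0 and natural subtraction is truncated. *)

Inductive nexp :=
| NConst of nat
| NReg of nat
| NAdd of nexp & nexp
| NSub of nexp & nexp
| NMul of nexp & nexp.

Inductive rexp :=
| RNat of nexp
| RGet of nat & nexp
| RAdd of rexp & rexp
| RSub of rexp & rexp
| RMul of rexp & rexp
| RDiv of rexp & rexp.

Inductive bexp :=
| BNLe of nexp & nexp
| BRLe of rexp & rexp
| BNot of bexp
| BAnd of bexp & bexp.

(* Cells [slice_off, slice_off + slice_len) of array [slice_arr]. *)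
Record slice := Slice { slice_arr : nat; slice_off : nexp; slice_len : nexp }.

Inductive cmd :=
| Skip
| NSet (x : nat) (e : nexp)
| RSet (k : nat) (i : nexp) (e : rexp)
(* cell [i] of array [k] := d_a(p, q), where p and q are read from the cells
   starting at [offp] of array [arrp] and at [offq] of array [arrq] *)
| Dist (k : nat) (i : nexp) (a : nexp)
       (arrp : nat) (offp : nexp) (arrq : nat) (offq : nexp)
| Seq (c1 c2 : cmd)
| If (b : bexp) (c1 c2 : cmd)
| While (b : bexp) (c : cmd)
(* run [c] in a fresh store with arguments [ns], [rs] passed by value, then copy
   the first [n] cells of its array 0 to array [k], starting at cell [i] *)
| Call (c : cmd) (ns : seq nexp) (rs : seq slice) (k : nat) (i n : nexp).

Record store (R : realType) := Store {
  nregs : nat -> nat;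
  arrays : nat -> nat -> R }.

Definition set_nreg (R : realType) (st : store R) (x m : nat) : store R :=
  Store (fun y => if y == x then m else nregs st y) (arrays st).

Definition set_block (R : realType) (st : store R) (k i n : nat)
    (f : nat -> R) : store R :=
  Store (nregs st)
    (fun l j => if [&& l == k, i <= j & j < i + n]%N then f (j - i)%N
                else arrays st l j).

(* Inputs: the naturals [ns] in the first registers, the lists of reals [rs] in
   the first arrays, zeros everywhere else. *)
Definition load (R : realType) (ns : seq nat) (rs : seq (seq R)) : store R :=
  Store (nth 0%N ns) (fun k => nth 0 (nth [::] rs k)).

Definition input_size (R : realType) (ns : seq nat) (rs : seq (seq R)) : nat :=
  (size ns + sumn (map size rs))%N.

Fixpoint neval (R : realType) (st : store R) (e : nexp) : nat :=
  match e with
  | NConst n => n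
  | NReg x => nregs st x
  | NAdd e1 e2 => (neval st e1 + neval st e2)%N
  | NSub e1 e2 => (neval st e1 - neval st e2)%N
  | NMul e1 e2 => (neval st e1 * neval st e2)%N
  end.

Fixpoint reval (R : realType) (st : store R) (e : rexp) : R :=
  match e with
  | RNat e => (neval st e)%:R
  | RGet k i => arrays st k (neval st i)
  | RAdd e1 e2 => reval st e1 + reval st e2
  | RSub e1 e2 => reval st e1 - reval st e2
  | RMul e1 e2 => reval st e1 * reval st e2
  | RDiv e1 e2 => reval st e1 / reval st e2
  end.

Fixpoint beval (R : realType) (st : store R) (b : bexp) : bool :=
  match b with
  | BNLe e1 e2 => (neval st e1 <= neval st e2)%N
  | BRLe e1 e2 => reval st e1 <= reval st e2
  | BNot b => ~~ beval st b
  | BAnd b1 b2 => beval st b1 && beval st b2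
  end.

Definition read_slice (R : realType) (st : store R) (sl : slice) : seq R :=
  mkseq (fun i => arrays st (slice_arr sl) (neval st (slice_off sl) + i)%N)
        (neval st (slice_len sl)).

Definition read_vec (R : realType) (S : nat) (st : store R) (k i : nat) :
    'rV[R]_S :=
  \row_(j < S) arrays st k (i + j)%N.

Fixpoint ncost (e : nexp) : nat :=
  match e with
  | NConst _ | NReg _ => 1
  | NAdd e1 e2 | NSub e1 e2 | NMul e1 e2 => (ncost e1 + ncost e2).+1
  end.

Fixpoint rcost (e : rexp) : nat :=
  match e with
  | RNat e => (ncost e).+1
  | RGet _ i => (ncost i).+1
  | RAdd e1 e2 | RSub e1 e2 | RMul e1 e2 | RDiv e1 e2 =>
      (rcost e1 + rcost e2).+1
  end.

Fixpoint bcost (b : bexp) : nat :=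
  match b with
  | BNLe e1 e2 => (ncost e1 + ncost e2).+1
  | BRLe e1 e2 => (rcost e1 + rcost e2).+1
  | BNot b => (bcost b).+1
  | BAnd b1 b2 => (bcost b1 + bcost b2).+1
  end.

Definition slice_cost (sl : slice) : nat :=
  (ncost (slice_off sl) + ncost (slice_len sl))%N.

Definition is_dirac (R : realType) (S : nat) (p : 'rV[R]_S) : bool :=
  [exists i, p == delta_mx 0 i].

Definition dist_cost (R : realType) (S : nat) (p q : 'rV[R]_S) : nat :=
  if is_dirac p || is_dirac q then 1 else S.

(* [exec d c st st' t]: started in [st], the command [c] halts in [st'] after
   [t] time units.  [Dist] is stuck unless [a] is a valid action and both
   arguments are probability vectors. *)
Inductive exec (R : realType) (S A : nat)
    (d : 'I_A -> 'rV[R]_S -> 'rV[R]_S -> R) :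
    cmd -> store R -> store R -> nat -> Prop :=
| ExecSkip st : exec d Skip st st 0
| ExecNSet x e st :
    exec d (NSet x e) st (set_nreg st x (neval st e)) (ncost e).+1
| ExecRSet k i e st :
    exec d (RSet k i e) st
      (set_block st k (neval st i) 1 (fun=> reval st e))
      (ncost i + rcost e).+1
| ExecDist k i a arrp offp arrq offq st (a0 : 'I_A)
    (p := read_vec S st arrp (neval st offp))
    (q := read_vec S st arrq (neval st offq)) :
    neval st a = a0 -> simplex S p -> simplex S q ->
    exec d (Dist k i a arrp offp arrq offq) st
      (set_block st k (neval st i) 1 (fun=> d a0 p q))
      (ncost i + ncost a + ncost offp + ncost offq + dist_cost p q).+1
| ExecSeq c1 c2 st st1 st2 t1 t2 :
    exec d c1 st st1 t1 -> exec d c2 st1 st2 t2 ->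
    exec d (Seq c1 c2) st st2 (t1 + t2)
| ExecIf b c1 c2 st st1 t :
    exec d (if beval st b then c1 else c2) st st1 t ->
    exec d (If b c1 c2) st st1 (bcost b + t).+1
| ExecWhileFalse b c st :
    ~~ beval st b -> exec d (While b c) st st (bcost b).+1
| ExecWhileTrue b c st st1 st2 t1 t2 :
    beval st b -> exec d c st st1 t1 -> exec d (While b c) st1 st2 t2 ->
    exec d (While b c) st st2 (bcost b + t1 + t2).+1
| ExecCall c ns rs k i n st st1 t
    (nvals := map (neval st) ns) (rvals := map (read_slice st) rs) :
    exec d c (load nvals rvals) st1 t ->
    exec d (Call c ns rs k i n) st
      (set_block st k (neval st i) (neval st n) (arrays st1 0%N))
      (sumn (map ncost ns) + sumn (map slice_cost rs) + ncost i + ncost n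
       + input_size nvals rvals + t + neval st n).+1.

(* The running time includes the time to read the input; hence a bound on the
   time of a procedure that takes a vector in R^S is at least linear in S.  On
   halting, array 0 holds the output. *)
Definition computes (R : realType) (S A : nat)
    (d : 'I_A -> 'rV[R]_S -> 'rV[R]_S -> R) (c : cmd)
    (ns : seq nat) (rs : seq (seq R)) (bound : R) (post : (nat -> R) -> Prop) :
    Prop :=
  exists st t,
    [/\ exec d c (load ns rs) st t,
        (input_size ns rs + t)%:R <= bound &
        post (arrays st 0%N)].

Definition vec_seq (R : realType) (n : nat) (u : 'rV[R]_n) : seq R :=
  [seq u 0 i | i <- enum 'I_n].

Definition table_seq (R : realType) (S A : nat)
    (f : 'I_S -> 'I_A -> 'rV[R]_S) : seq R :=
  flatten [seq flatten [seq vec_seq (f s a) | a <- enum 'I_A] | s <- enum 'I_S].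

(** * Computability in time O(...)

    [d S A a] is the deviation function of action [a] in problems with [S]
    states and [A] actions.  The program and the hidden constant are uniform in
    the dimensions and in all of the numerical data. *)

Definition deviation_family (R : realType) : Type :=
  forall S A : nat, 'I_A -> 'rV[R]_S -> 'rV[R]_S -> R.

Definition projection_computable (R : realType) (d : deviation_family R)
    (h : nat -> R -> R) : Prop :=
  exists (c : cmd) (C : R), 0 < C /\ forall (S A : nat) (a : 'I_A)
      (pbar b : 'rV[R]_S) (beta delta : R),
    simplex S pbar -> (forall i, 0 <= b 0 i) -> 0 <= beta ->
    (exists i, b 0 i <= beta) -> 0 < delta ->
    computes (d S A) c [:: S; A; nat_of_ord a]
      [:: vec_seq pbar; vec_seq b; [:: beta; delta]]
      (C * h S delta)
      (fun out =>
         projection_accurate (d S A a) pbar b beta delta (out 0%N) (out 1%N)).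

(* [time S A M eps] is the claimed order of the running time.  On ['rV_S] the
   library norm [`| _ |] is the maximum norm. *)
Definition bellman_computable (R : realType) (d : deviation_family R)
    (time : forall S A : nat, rmdp R S A -> R -> R) : Prop :=
  exists (c : cmd) (C : R), 0 < C /\ forall (S A : nat) (M : rmdp R S A)
      (v : 'rV[R]_S) (eps : R),
    (0 < S)%N -> (0 < A)%N -> valid_rmdp M ->
    (forall s, 0 <= v 0 s <= Rbar M) -> 0 < eps ->
    computes (d S A) c [:: S; A]
      [:: vec_seq v; table_seq (reward M); table_seq (nominal M);
          [:: discount M; budget M; eps]]
      (C * time S A M eps)
      (fun out => `| (\row_s out (nat_of_ord s)) - bellman (d S A) M v | <= eps).

(* The argument will be Rbar / eps.  As eps grows to Rbar its logarithm decreases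
   to 0, and it is negative beyond, so that no running time can be bounded by a
   multiple of it; whence the lower bound 1, which is inactive as soon as
   eps <= Rbar / e. *)
Definition log_max1 (R : realType) (x : R) : R := Num.max 1 (ln x).

(* Main.v *)
Require Import Defs.
From mathcomp Require Import all_boot all_order all_algebra.
From mathcomp Require Import all_classical all_reals all_analysis.
From mathcomp Require Import ring lra zify.
Set Implicit Arguments.
Unset Strict Implicit.
Unset Printing Implicit Defensive.
Import Order.TTheory GRing.Theory Num.Theory.
Local Open Scope ring_scope.

(** Fix a state [s] and put [b a := reward s a + discount *: v].  The objective
    is linear in the weights of the policy and linear in the transition vectors,
    so a minimax theorem ([robust_value_minimax]) turns the component [s] of the
    Bellman iterate into the infimum, over the ambiguity set, of the largest
    payoff [dotv (p a) (b a)].  This value is at most [theta] as soon as every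
    action can be pushed down to a payoff of at most [theta] within the budget,
    and the cheapest way to do so costs the sum over [a] of the projection values
    at [theta].  Hence a bisection on [theta], with one projection per action
    and per step.

    The projections are only known up to [delta], and the test compares the sum
    of their upper bounds with the budget [kappa].
    - If the sum is below [kappa], then [theta] is a true upper bound on the
      value ([robust_value_le_of_projections]).
    - Otherwise the exact sum is at least [kappa - A * delta], and
      [theta - eps / 2] is a lower bound on the value
      ([robust_value_ge_of_projections]).  If it were not, some [p] in the
      ambiguity set would have payoffs at most [theta - eps / 2]; moving [p]
      towards the nominal vectors by the fraction [t = eps / (2 * Rbar)] would
      raise the payoffs to at most [theta], while convexity would bring the
      deviation down to [(1 - t) * kappa], which is less than
      [kappa - A * delta] for the chosen [delta].
    So [lo - eps / 2 <= value <= hi] persists, and [lo] is an admissible answer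
    once [hi - lo <= eps].  The search starts from [hi = Rbar] and from
    [lo = max_a min_i b a i], above which all projections are feasible.

    The infima may fail to be attained.  This is why the minimax theorem is
    proved up to an arbitrarily small error, from an almost nearest point of a
    convex set to an orthant, and why the test of the first case is strict.

    For the running time, [Rbar <= eps * 2 ^ N] bounds the number of bisection
    steps by [N], and some such [N] is of the order of [log_max1 (Rbar / eps)]
    ([halvings]).  A step costs [A] projections and a number of operations of the
    order of [A * S], which the projections dominate since they read vectors of
    length [S].  The same remark pays for reading the tables of size
    [S * A * S].  Programs are verified in a logic of total correctness with
    time bounds ([reaches]); each procedure runs in a fresh store, so that its
    specification only speaks of its inputs. *)

(** * The probability simplex *)

Section Simplex.

Context (R : realType) (n : nat).
Implicit Types (p q c : 'rV[R]_n) (m t : R).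

Lemma weighted_le p (x : 'I_n -> R) m :
  simplex n p -> (forall i, x i <= m) -> \sum_i p 0 i * x i <= m.
Proof.
move=> [p0 p1] xm; rewrite -[m]mul1r -p1 mulr_suml.
by apply: ler_sum => i _; apply: ler_wpM2l.
Qed.

Lemma dotv_le p c m : simplex n p -> (forall i, c 0 i <= m) -> dotv p c <= m.
Proof. exact: weighted_le. Qed.

Lemma dotv_ge p c m : simplex n p -> (forall i, m <= c 0 i) -> m <= dotv p c.
Proof.
move=> [p0 p1] cm; rewrite -[m]mul1r -p1 mulr_suml /dotv.
by apply: ler_sum => i _; apply: ler_wpM2l.
Qed.

Lemma simplex_delta i : simplex n (delta_mx 0 i : 'rV[R]_n).
Proof.
split=> [j|]; first by rewrite mxE eqxx /=; case: eqP.
rewrite (bigD1 i) //= mxE !eqxx big1 ?addr0 // => j /negPf nj.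
by rewrite mxE nj andbF.
Qed.

Lemma dotv_delta i c : dotv (delta_mx 0 i) c = c 0 i.
Proof.
rewrite /dotv (bigD1 i) //= mxE !eqxx mul1r big1 ?addr0 // => j /negPf nj.
by rewrite mxE nj andbF mul0r.
Qed.

Lemma simplex_mix p q t :
  simplex n p -> simplex n q -> 0 <= t <= 1 -> simplex n (p + t *: (q - p)).
Proof.
move=> [p0 p1] [q0 q1] /andP[t0 t1]; split=> [i|].
  by rewrite !mxE; have := p0 i; have := q0 i; nra.
under eq_bigr do rewrite !mxE.
by rewrite big_split -mulr_sumr sumrB /= p1 q1 subrr mulr0 addr0.
Qed.

Lemma dotv_mix p q c t :
  dotv (p + t *: (q - p)) c = dotv p c + t * (dotv q c - dotv p c).
Proof.
rewrite /dotv -sumrB mulr_sumr -big_split; apply: eq_bigr => i _.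
by rewrite !mxE /=; ring.
Qed.

End Simplex.

(** * Minimax *)

(** Second-order upper bound on the squared distance to the negative half-line;
    the linear term is the derivative of [u |-> max u 0 ^+ 2]. *)
Lemma sqr_max0_le (R : realType) (u s : R) :
  Num.max (u + s) 0 ^+ 2 <= Num.max u 0 ^+ 2 + 2 * Num.max u 0 * s + s ^+ 2.
Proof. by rewrite /Num.max; case: ifP; case: ifP => *; nra. Qed.

(** Let [f] be the squared distance to the orthant of the points below
    [theta - e / 2].  At an almost minimal point [x0] of [f] on [X], the vector
    [w x0] of the violations is almost an outer normal of that orthant: along the
    segment from [x0] to any [x] in [X] the function [f] hardly decreases, so
    [\sum_a w x0 a * (x a - x0 a)] is almost nonnegative.  Dividing [w x0] by its
    sum, which is at least [e / 2], gives the weights. *)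
Lemma minimax_weights (R : realType) (A : nat) (X : set ('I_A -> R))
    (B theta e : R) :
  (X !=set0)%classic ->
  (forall x y t, X x -> X y -> 0 <= t <= 1 ->
     X (fun a => x a + t * (y a - x a))) ->
  (forall x a, X x -> 0 <= x a <= B) ->
  (forall x, X x -> exists a, theta < x a) -> 0 < e ->
  exists2 pi : 'rV[R]_A, simplex A pi &
    forall x, X x -> theta - e <= \sum_a pi 0 a * x a.
Proof.
move=> [z Xz] Xconv Xbnd Xabove e0.
pose w (x : 'I_A -> R) a := Num.max (x a - (theta - e / 2)) 0.
pose f (x : 'I_A -> R) := \sum_a w x a ^+ 2.
pose K := A%:R * B ^+ 2 + e ^+ 2.
have K0 : 0 < K.
  by apply: ltr_wpDl; [rewrite mulr_ge0 ?sqr_ge0 | rewrite exprn_gt0].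
(* With this step, the slope below is at least [- (t * K)], and
   [t * K = e ^+ 2 / 4] is at most [e / 2 * W]. *)
pose t := e ^+ 2 / (4 * K).
have tK : t * K = e ^+ 2 / 4 by rewrite /t; field; lra.
have t0 : 0 < t by rewrite divr_gt0 ?exprn_gt0 // mulr_gt0.
have t1 : t <= 1.
  rewrite ler_pdivrMr ?mulr_gt0 // mul1r.
  have : e ^+ 2 <= K by rewrite lerDr mulr_ge0 ?sqr_ge0.
  lra.
pose F : set R := [set f x | x in X]%classic.
have lbF : has_lbound F.
  by exists 0 => _ [x _ <-]; apply: sumr_ge0 => a _; exact: sqr_ge0.
have infF : has_inf F by split=> //; exists (f z), z.
have eta0 : 0 < t ^+ 2 * K by rewrite mulr_gt0 ?exprn_gt0.
have [_ [x0 Xx0 <-] fx0] := inf_adherent eta0 infF.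
have w_ge0 a : 0 <= w x0 a by rewrite /w le_max lexx orbT.
pose W := \sum_a w x0 a.
have We : e / 2 <= W.
  have [a xa] := Xabove _ Xx0.
  rewrite /W (bigD1 a) //= -[leLHS]addr0 lerD ?sumr_ge0 //.
  by rewrite /w le_max; apply/orP; left; lra.
have W0 : 0 < W by lra.
exists (\row_a (w x0 a / W)).
  split=> [a|]; first by rewrite mxE divr_ge0 // ltW.
  by under eq_bigr do rewrite mxE; rewrite -mulr_suml divff // gt_eqF.
move=> x Xx.
have wx0 : (theta - e / 2) * W <= \sum_a w x0 a * x0 a.
  rewrite mulr_sumr; apply: ler_sum => a _; rewrite mulrC.
  by rewrite /w /Num.max; case: ifP => ?; nra.
have step : inf F <= f (fun a => x0 a + t * (x a - x0 a)).
  apply: ge_inf => //; exists (fun a => x0 a + t * (x a - x0 a)) => //.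
  by apply: Xconv; rewrite // t1 ltW.
have fstep : f (fun a => x0 a + t * (x a - x0 a)) <=
    f x0 + 2 * t * (\sum_a w x0 a * (x a - x0 a)) + t ^+ 2 * (A%:R * B ^+ 2).
  have -> : A%:R * B ^+ 2 = \sum_(a < A) B ^+ 2.
    by rewrite sumr_const card_ord mulr_natl.
  rewrite !mulr_sumr -!big_split /=; apply: ler_sum => a _.
  have -> : w (fun a0 => x0 a0 + t * (x a0 - x0 a0)) a =
      Num.max (x0 a - (theta - e / 2) + t * (x a - x0 a)) 0.
    by rewrite /w addrAC.
  apply: le_trans (sqr_max0_le _ _) _; rewrite -/(w x0 a).
  have /andP[??] := Xbnd _ a Xx; have /andP[??] := Xbnd _ a Xx0.
  have qB : (x a - x0 a) ^+ 2 <= B ^+ 2 by nra.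
  have := ler_wpM2l (sqr_ge0 t) qB.
  rewrite (exprMn _ t) -/t.
  have -> : 2 * w x0 a * (t * (x a - x0 a)) =
    2 * t * (w x0 a * (x a - x0 a)) by ring.
  lra.
have : - (t * K) <= \sum_a w x0 a * (x a - x0 a).
  have : A%:R * B ^+ 2 <= K by rewrite lerDl sqr_ge0.
  move: (\sum_a w x0 a * (x a - x0 a)) fstep step fx0 t0 => g.
  move: (f _) (f _) (inf F) (A%:R * _) => ? ? ? ? ? ? ? ? ?.
  rewrite -(ler_pM2l (_ : 0 < 2 * t)); last by lra.
  nra.
under eq_bigr do rewrite mulrBr; rewrite sumrB tK => slope.
have -> : \sum_a (\row_a0 (w x0 a0 / W)) 0 a * x a = (\sum_a w x0 a * x a) / W.
  by rewrite mulr_suml; apply: eq_bigr => a _; rewrite mxE mulrAC.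
rewrite ler_pdivlMr //; nra.
Qed.

(** * The robust value of one state *)

Section RobustState.

Context (R : realType) (S A : nat).
Context (d : 'I_A -> 'rV[R]_S -> 'rV[R]_S -> R) (pbar b : 'I_A -> 'rV[R]_S).
Context (kappa B : R).
Hypothesis d_deviation : forall a, deviation (d a).
Hypothesis pbar_simplex : forall a, simplex S (pbar a).
Hypothesis kappa_gt0 : 0 < kappa.
Hypothesis b_bounds : forall a i, 0 <= b a 0 i <= B.
Hypothesis A_gt0 : (0 < A)%N.

Definition budget_set : set ('I_A -> 'rV[R]_S) :=
  [set p | (forall a, simplex S (p a)) /\
           \sum_a d a (p a) (pbar a) <= kappa]%classic.

(** A component of the Bellman iterate, with [b a] in the place of
    [reward M s a + discount M *: v]. *)
Definition robust_value : R :=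
  sup [set inf [set \sum_a pi 0 a * dotv (p a) (b a) | p in budget_set]
      | pi in simplex A]%classic.

Lemma dotv_b_bounds a p : simplex S p -> 0 <= dotv p (b a) <= B.
Proof.
move=> Sp; apply/andP; split.
  by apply: dotv_ge => // i; case/andP: (b_bounds a i).
by apply: dotv_le => // i; case/andP: (b_bounds a i).
Qed.

Lemma deviation_mix a (p q r : 'rV[R]_S) (t : R) :
  simplex S p -> simplex S q -> simplex S r -> 0 <= t <= 1 ->
  d a (p + t *: (q - p)) r <= d a p r + t * (d a q r - d a p r).
Proof.
move=> Sp Sq Sr t01; have [/(_ r Sr) cvx _ _] := d_deviation a.
have /= h := cvx (Itv01 (andP t01).1 (andP t01).2) q p.
have {h} : d a (t *: q + (1 - t) *: p) r <= t * d a q r + (1 - t) * d a p r.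
  by apply: h; rewrite inE.
have -> : t *: q + (1 - t) *: p = p + t *: (q - p).
  by rewrite scalerBr scalerBl scale1r addrCA.
lra.
Qed.

Lemma budget_set_nominal : budget_set pbar.
Proof.
split=> //; rewrite big1 ?ltW // => a _.
have [_ _ d0] := d_deviation a; exact/d0.
Qed.

Lemma budget_set_mix (p q : 'I_A -> 'rV[R]_S) (t : R) :
  budget_set p -> budget_set q -> 0 <= t <= 1 ->
  budget_set (fun a => p a + t *: (q a - p a)).
Proof.
move=> [Sp dp] [Sq dq] t01; split=> [a|]; first exact: simplex_mix.
apply: (@le_trans _ _ (\sum_a (d a (p a) (pbar a) +
    t * (d a (q a) (pbar a) - d a (p a) (pbar a))))).
  by apply: ler_sum => a _; apply: deviation_mix.
rewrite big_split -mulr_sumr sumrB /=; move/andP: t01 => [t0 t1]; nra.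
Qed.

Let payoffs (pi : 'rV[R]_A) : set R :=
  [set \sum_a pi 0 a * dotv (p a) (b a) | p in budget_set]%classic.

Lemma payoffs_lbound pi : simplex A pi -> lbound (payoffs pi) 0.
Proof.
move=> [pi0 _] _ [p [Sp _] <-]; apply: sumr_ge0 => a _.
by rewrite mulr_ge0 //; case/andP: (dotv_b_bounds a (Sp a)).
Qed.

Lemma inf_payoffs_le pi p (theta : R) :
  simplex A pi -> budget_set p -> (forall a, dotv (p a) (b a) <= theta) ->
  inf (payoffs pi) <= theta.
Proof.
move=> Spi Pp ptheta; apply: (@le_trans _ _ (\sum_a pi 0 a * dotv (p a) (b a))).
  apply: ge_inf; last by exists p.
  by exists 0; exact: payoffs_lbound.
exact: weighted_le.
Qed.

Lemma robust_value_le p (theta : R) :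
  budget_set p -> (forall a, dotv (p a) (b a) <= theta) ->
  robust_value <= theta.
Proof.
move=> Pp ptheta; apply: ge_sup.
  pose pi : 'rV[R]_A := delta_mx 0 (Ordinal A_gt0).
  by exists (inf (payoffs pi)), pi => //; exact: simplex_delta.
by move=> _ [pi Spi <-]; exact: (inf_payoffs_le Spi Pp).
Qed.

Lemma robust_value_leB : robust_value <= B.
Proof.
apply: (robust_value_le budget_set_nominal) => a.
by case/andP: (dotv_b_bounds a (pbar_simplex a)).
Qed.

(** Otherwise every payoff vector exceeds [theta] in some coordinate, and
    [minimax_weights] provides a policy whose guaranteed payoff exceeds
    [robust_value]. *)
Lemma robust_value_minimax (theta : R) : robust_value < theta ->
  exists2 p, budget_set p & forall a, dotv (p a) (b a) <= theta.
Proof.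
move=> lt_theta; apply: contrapT => no_p.
pose X : set ('I_A -> R) :=
  [set (fun a => dotv (p a) (b a)) | p in budget_set]%classic.
have X0 : (X !=set0)%classic.
  by eexists; exists pbar; [exact: budget_set_nominal | reflexivity].
have Xconv x y t : X x -> X y -> 0 <= t <= 1 ->
    X (fun a => x a + t * (y a - x a)).
  move=> [p Pp <-] [q Pq <-] t01.
  exists (fun a => p a + t *: (q a - p a)); first exact: budget_set_mix.
  by apply/funext => a; rewrite dotv_mix.
have Xbnd x a : X x -> 0 <= x a <= B.
  by move=> [p [Sp _] <-]; exact: dotv_b_bounds.
have Xabove x : X x -> exists a, theta < x a.
  move=> [p Pp <-]; apply: contrapT => no_a; apply: no_p; exists p => // a.
  by rewrite leNgt; apply/negP => lt_a; apply: no_a; exists a.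
have e0 : 0 < (theta - robust_value) / 2 by lra.
have [pi Spi piX] := minimax_weights X0 Xconv Xbnd Xabove e0.
have : theta - (theta - robust_value) / 2 <= robust_value; last by lra.
apply: le_trans (_ : inf (payoffs pi) <= _).
  apply: lb_le_inf.
    by eexists; exists pbar; [exact: budget_set_nominal | reflexivity].
  by move=> _ [p Pp <-]; apply: (piX (fun a => dotv (p a) (b a))); exists p.
apply: ub_le_sup; last by exists pi.
exists B => _ [rho Srho <-]; apply: (inf_payoffs_le Srho budget_set_nominal).
by move=> a; case/andP: (dotv_b_bounds a (pbar_simplex a)).
Qed.

(** Used with [m = min_i b a 0 i]: the thresholds at which some projection is
    infeasible are below the value. *)
Lemma robust_value_ge a (m : R) :
  (forall i, m <= b a 0 i) -> m <= robust_value.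
Proof.
move=> mb; rewrite leNgt; apply/negP => lt_m.
have [p [Sp _] pm] := @robust_value_minimax ((m + robust_value) / 2) ltac:(lra).
have := dotv_ge (Sp a) mb; have := pm a; lra.
Qed.

Lemma projection_ub a p theta : simplex S p -> dotv p (b a) <= theta ->
  projection (d a) (pbar a) (b a) theta <= d a p (pbar a).
Proof.
move=> Sp ptheta; apply: ge_inf; last by exists p.
exists 0 => _ [q [Sq _] <-]; have [_ d0 _] := d_deviation a; exact: d0.
Qed.

(** The gap [kappa - \sum_a hi a] is shared among the actions, so that vectors
    almost attaining the projections already fit into the budget. *)
Lemma robust_value_le_of_projections (theta : R) (hi : 'I_A -> R) :
  (forall a, exists i, b a 0 i <= theta) ->
  (forall a, projection (d a) (pbar a) (b a) theta <= hi a) ->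
  \sum_a hi a < kappa -> robust_value <= theta.
Proof.
move=> feas projhi sumhi.
pose eta := (kappa - \sum_a hi a) / A%:R.
have A0 : 0 < A%:R :> R by rewrite ltr0n.
have eta0 : 0 < eta by rewrite divr_gt0 ?subr_gt0.
have near a : exists p, [/\ simplex S p, dotv p (b a) <= theta &
    d a p (pbar a) <= hi a + eta].
  pose D := [set d a p (pbar a) |
     p in [set p | simplex S p /\ dotv p (b a) <= theta]]%classic.
  have [i bi] := feas a.
  have infD : has_inf D.
    split; last first.
      by exists 0 => _ [q [Sq _] <-]; have [_ d0 _] := d_deviation a; exact: d0.
    exists (d a (delta_mx 0 i) (pbar a)), (delta_mx 0 i) => //; split.
      exact: simplex_delta.
    by rewrite dotv_delta.
  have [_ [p [Sp pb] <-] dp] := inf_adherent eta0 infD.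
  exists p; split => //; apply: le_trans (ltW dp) _.
  by rewrite lerD2r; exact: projhi.
have [p pP] := fin_all_exists near.
apply: (@robust_value_le p); last by move=> a; case: (pP a).
split=> [a|]; first by case: (pP a).
apply: (@le_trans _ _ (\sum_a (hi a + eta))).
  by apply: ler_sum => a _; case: (pP a).
rewrite big_split sumr_const card_ord /= -[eta *+ _]mulr_natr /eta.
by rewrite divfK ?gt_eqF // subrKC.
Qed.

(** If the bound failed, a vector [p] of the budget set with payoffs at most
    [theta - eps / 2], mixed with the nominal one, would show that the
    projections sum up to too little. *)
Lemma robust_value_ge_of_projections (theta eps delta : R) (hi : 'I_A -> R) :
  0 <= theta -> 0 < eps -> eps <= B ->
  (forall a, hi a <= projection (d a) (pbar a) (b a) theta + delta) ->
  delta = eps * kappa / (2 * A%:R * B + A%:R * eps) ->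
  kappa <= \sum_a hi a -> theta - eps / 2 <= robust_value.
Proof.
move=> theta0 eps0 epsB projhi delta_def sumhi.
rewrite leNgt; apply/negP => lt_theta.
have [p [Sp dp] ptheta] := robust_value_minimax lt_theta.
have B0 : 0 < B by lra.
have A0 : 0 < A%:R :> R by rewrite ltr0n.
(* The largest mixing weight that surely raises payoffs by at most [eps / 2]. *)
pose t := eps / (2 * B).
have t0 : 0 < t by rewrite divr_gt0 // mulr_gt0.
have t1 : t <= 1 by rewrite ler_pdivrMr ?mulr_gt0 // mul1r; lra.
have tB : t * B = eps / 2 by rewrite /t; field; lra.
have projp a : projection (d a) (pbar a) (b a) theta <=
    d a (p a) (pbar a) * (1 - t).
  pose q := p a + t *: (pbar a - p a).
  have t01 : 0 <= t <= 1 by rewrite t1 ltW.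
  apply: (@le_trans _ _ (d a q (pbar a))).
    apply: projection_ub; first exact: simplex_mix.
    rewrite dotv_mix; have := ptheta a.
    have /andP[] := dotv_b_bounds a (Sp a).
    have /andP[] := dotv_b_bounds a (pbar_simplex a).
    nra.
  apply: le_trans (deviation_mix _ _ _ _ _) _ => //.
  have [_ _ /(_ (pbar a) (pbar a)) d0] := d_deviation a.
  have -> : d a (pbar a) (pbar a) = 0 by apply/d0.
  by rewrite le_eqVlt; apply/orP; left; apply/eqP; ring.
have : \sum_a hi a <= kappa * (1 - t) + A%:R * delta.
  apply: (@le_trans _ _ (\sum_a (d a (p a) (pbar a) * (1 - t) + delta))).
    apply: ler_sum => a _; apply: le_trans (projhi a) _.
    by rewrite lerD2r.
  rewrite big_split /= sumr_const card_ord -[delta *+ _]mulr_natl lerD2r.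
  by rewrite -mulr_suml ler_wpM2r // subr_ge0.
have Adelta : A%:R * delta = eps * kappa / (2 * B + eps).
  by rewrite delta_def; field; rewrite !gt_eqF //; nra.
have : eps * kappa / (2 * B + eps) < t * kappa.
  rewrite mulrAC ltr_pM2r // ltr_pdivrMr; last by lra.
  rewrite mulrDr mulrA [t * 2]mulrC -mulrA tB.
  have : 0 < t * eps by rewrite mulr_gt0.
  lra.
rewrite Adelta; lra.
Qed.

End RobustState.

(** * Total correctness with time bounds *)

Section CostLogic.

Context (R : realType) (S A : nat).
Context (d : 'I_A -> 'rV[R]_S -> 'rV[R]_S -> R).
Implicit Types (c : cmd) (st : store R) (Q : store R -> Prop).

(** A weakest precondition with an upper bound [T] on the time instead of the
    exact time, so that bounds compose and may be rounded up. *)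
Definition reaches c st (T : nat) Q : Prop :=
  exists st' t, [/\ exec d c st st' t, (t <= T)%N & Q st'].

Lemma reaches_weaken c st T T' Q Q' :
  reaches c st T Q -> (forall st', Q st' -> Q' st') -> (T <= T')%N ->
  reaches c st T' Q'.
Proof.
move=> [st' [t [run tT Qst]]] QQ TT; exists st', t; split=> //; last exact: QQ.
exact: leq_trans TT.
Qed.

Lemma reaches_le c st T T' Q :
  reaches c st T Q -> (T <= T')%N -> reaches c st T' Q.
Proof. by move=> h; exact: reaches_weaken h _. Qed.

Lemma reaches_skip st Q : Q st -> reaches Skip st 0 Q.
Proof. by move=> ?; exists st, 0%N; split=> //; exact: ExecSkip. Qed.

Lemma reaches_nset x e st Q :
  Q (set_nreg st x (neval st e)) -> reaches (NSet x e) st (ncost e).+1 Q.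
Proof. by move=> ?; do 2 eexists; split; [exact: ExecNSet | |]. Qed.

Lemma reaches_rset k i e st Q :
  Q (set_block st k (neval st i) 1 (fun=> reval st e)) ->
  reaches (RSet k i e) st (ncost i + rcost e).+1 Q.
Proof. by move=> ?; do 2 eexists; split; [exact: ExecRSet | |]. Qed.

Lemma reaches_seq c1 c2 st T1 T2 Q :
  reaches c1 st T1 (fun st1 => reaches c2 st1 T2 Q) ->
  reaches (Seq c1 c2) st (T1 + T2) Q.
Proof.
move=> [st1 [t1 [run1 le1 [st2 [t2 [run2 le2 Qst]]]]]].
by exists st2, (t1 + t2)%N; split; [exact: ExecSeq run2 | exact: leq_add |].
Qed.

Lemma reaches_if b c1 c2 st T Q :
  reaches (if beval st b then c1 else c2) st T Q ->
  reaches (If b c1 c2) st (bcost b + T).+1 Q.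
Proof.
move=> [st1 [t [run le Qst]]]; exists st1, (bcost b + t).+1.
by split=> //; [exact: ExecIf | rewrite ltnS leq_add2l].
Qed.

Lemma reaches_call c ns rs k i n st T Q :
  reaches c (load (map (neval st) ns) (map (read_slice st) rs)) T
    (fun st1 => Q (set_block st k (neval st i) (neval st n) (arrays st1 0%N))) ->
  reaches (Call c ns rs k i n) st
    (sumn (map ncost ns) + sumn (map slice_cost rs) + ncost i + ncost n
     + (size ns + sumn [seq neval st (slice_len sl) | sl <- rs])
     + T + neval st n).+1 Q.
Proof.
move=> [st1 [t [run le Qst]]]; do 2 eexists; split; last exact: Qst.
  exact: ExecCall run.
rewrite ltnS leq_add2r leq_add // leq_add2l /input_size size_map -map_comp.
by rewrite (eq_map (fun sl => size_mkseq _ _ : _ = neval st (slice_len sl))).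
Qed.

(** The index of the invariant [I] bounds the number of iterations to come. *)
Lemma reaches_while (I : nat -> store R -> Prop) b c T n st :
  (forall m st, I m st -> beval st b ->
     exists2 m', m = m'.+1 & reaches c st T (I m')) ->
  I n st ->
  reaches (While b c) st (n * (bcost b + T).+1 + (bcost b).+1)
    (fun st' => (exists m, I m st') /\ ~~ beval st' b).
Proof.
move=> body; elim: n st => [|n IHn] st Ist.
  case: (boolP (beval st b)) => [/(body _ _ Ist)[] // | nb].
  exists st, (bcost b).+1; split=> //; first exact: ExecWhileFalse.
  by split=> //; exists 0%N.
case: (boolP (beval st b)) => [bst | nb]; last first.
  exists st, (bcost b).+1; split; first exact: ExecWhileFalse.
    by rewrite leq_addl.
  by split=> //; exists n.+1.
have [_ [<-] [st1 [t1 [run1 le1 /IHn[st2 [t2 [run2 le2 Qst]]]]]]] :=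
  body _ _ Ist bst.
exists st2, (bcost b + t1 + t2).+1; split=> //.
  exact: ExecWhileTrue run1 run2.
lia.
Qed.

Definition for_loop (x : nat) (e : nexp) (body : cmd) : cmd :=
  Seq (NSet x (NConst 0))
    (While (BNot (BNLe e (NReg x)))
       (Seq body (NSet x (NAdd (NReg x) (NConst 1))))).

(** The invariant [J i] must be insensitive to the counter register [x], whose
    value is handed separately to the body. *)
Lemma reaches_for (J : nat -> store R -> Prop) x e n body T st Q :
  (forall i st', J i st' -> neval st' e = n) ->
  (forall i st' m, J i st' -> J i (set_nreg st' x m)) ->
  (forall i st', (i < n)%N -> nregs st' x = i -> J i st' ->
     reaches body st' T (fun st1 => nregs st1 x = i /\ J i.+1 st1)) ->
  J 0%N st -> (forall st', J n st' -> Q st') ->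
  reaches (for_loop x e body) st (n * (T + ncost e + 8) + ncost e + 8) Q.
Proof.
move=> Je Jx Jbody J0 JQ.
pose I k st' := [/\ (nregs st' x + k)%N = n & J (nregs st' x) st'].
eapply reaches_le.
  apply: reaches_seq; apply: reaches_nset.
  apply: (reaches_weaken _ _ (leqnn _)); first apply: (@reaches_while I _ _
      (T + 4) n).
  - move=> m st' [mE Jst]; rewrite /= (Je _ _ Jst) -ltnNge => lt_n.
    case: m mE => [|m] mE; first by move: lt_n; rewrite -mE addn0 ltnn.
    exists m => //; apply: reaches_seq; apply: reaches_weaken (leqnn _).
      exact: (Jbody (nregs st' x) st').
    move=> st1 [x1 Jst1]; apply: reaches_nset; split; rewrite /= eqxx x1 addn1.
      by rewrite addSnnS.
    exact: Jx.
  - by split; rewrite /= eqxx //; exact: Jx.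
  move=> st' [[m [mE Jst]]]; rewrite /= negbK (Je _ _ Jst) => le_n.
  by apply: JQ; have -> : n = nregs st' x by lia.
rewrite /=; nia.
Qed.

End CostLogic.

(** * The procedures *)

Lemma nth_read_slice (R : realType) (st : store R) sl j :
  (j < neval st (slice_len sl))%N ->
  nth 0 (read_slice st sl) j =
  arrays st (slice_arr sl) (neval st (slice_off sl) + j)%N.
Proof. by move=> ltj; rewrite nth_mkseq. Qed.

Lemma read_slice_vec (R : realType) (S : nat) (st : store R) sl (u : 'rV[R]_S) :
  neval st (slice_len sl) = S ->
  (forall j : 'I_S,
     arrays st (slice_arr sl) (neval st (slice_off sl) + j)%N = u 0 j) ->
  read_slice st sl = vec_seq u.
Proof.
move=> lenS cells; rewrite /read_slice lenS /mkseq /vec_seq -val_enum_ord.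
by rewrite -map_comp; apply: eq_map => j /=; rewrite cells.
Qed.

(** Here and below, the registers 0 and 1 hold [S] and [A], and the entry [j] of
    the vector of action [a] is stored in the cell [a * S + j].

    Arrays: 0 nominal vectors, 1 vectors [b], 2 the threshold and the accuracy,
    3 output of a projection, 4 accumulator.  Only the upper bounds are summed,
    that is, cell 1 of the output of [c]. *)
Definition sum_proc (c : cmd) : cmd :=
  Seq
    (for_loop 2 (NReg 1)
       (Seq
          (Call c [:: NReg 0; NReg 1; NReg 2]
             [:: Slice 0 (NMul (NReg 2) (NReg 0)) (NReg 0);
                 Slice 1 (NMul (NReg 2) (NReg 0)) (NReg 0);
                 Slice 2 (NConst 0) (NConst 2)]
             3 (NConst 0) (NConst 2))
          (RSet 4 (NConst 0)
             (RAdd (RGet 4 (NConst 0)) (RGet 3 (NConst 1))))))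
    (RSet 0 (NConst 0) (RGet 4 (NConst 0))).

(** Arrays: 0 nominal vectors, 1 vectors [b], 2 the cells
    [lo; hi; kappa; eps; delta], 3 the midpoint and [delta], 4 the sum. *)
Definition bisect_proc (c : cmd) : cmd :=
  let lo := RGet 2 (NConst 0) in
  let hi := RGet 2 (NConst 1) in
  let kappa := RGet 2 (NConst 2) in
  let eps := RGet 2 (NConst 3) in
  let delta := RGet 2 (NConst 4) in
  let mid := RGet 3 (NConst 0) in
  let table := NMul (NReg 1) (NReg 0) in
  Seq
    (While (BNot (BRLe (RSub hi lo) eps))
       (Seq (RSet 3 (NConst 0) (RDiv (RAdd lo hi) (RNat (NConst 2))))
       (Seq (RSet 3 (NConst 1) delta)
       (Seq (Call (sum_proc c) [:: NReg 0; NReg 1]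
               [:: Slice 0 (NConst 0) table; Slice 1 (NConst 0) table;
                   Slice 3 (NConst 0) (NConst 2)]
               4 (NConst 0) (NConst 1))
            (If (BRLe kappa (RGet 4 (NConst 0)))
               (RSet 2 (NConst 0) mid)
               (RSet 2 (NConst 1) mid))))))
    (RSet 0 (NConst 0) lo).

(** Arrays: 0 the vector [v], 1 rewards, 2 nominal vectors, 3 the cells
    [discount; kappa; eps; Rbar; delta], 4 the vectors [b], 5 the minimum of
    [b a], 6 the parameters of the bisection.  Cell 0 of array 6 accumulates the
    left end [max_a min_i b a i]; its initial value 0 is harmless because [b] is
    nonnegative. *)
Definition state_proc (c : cmd) : cmd :=
  let table := NMul (NReg 1) (NReg 0) in
  let cell j := NAdd (NMul (NReg 2) (NReg 0)) j in
  let b j := RAdd (RGet 1 (cell j)) (RMul (RGet 3 (NConst 0)) (RGet 0 j)) in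
  let copy k i := RSet 6 (NConst k) (RGet 3 (NConst i)) in
  Seq
    (for_loop 2 (NReg 1)
       (Seq (RSet 5 (NConst 0) (b (NConst 0)))
       (Seq (for_loop 3 (NReg 0)
               (Seq (RSet 4 (cell (NReg 3)) (b (NReg 3)))
                    (If (BRLe (RGet 5 (NConst 0)) (RGet 4 (cell (NReg 3))))
                       Skip
                       (RSet 5 (NConst 0) (RGet 4 (cell (NReg 3)))))))
            (If (BRLe (RGet 5 (NConst 0)) (RGet 6 (NConst 0)))
               Skip
               (RSet 6 (NConst 0) (RGet 5 (NConst 0)))))))
    (Seq (copy 1 3) (Seq (copy 2 1) (Seq (copy 3 2) (Seq (copy 4 4)
       (Call (bisect_proc c) [:: NReg 0; NReg 1]
          [:: Slice 2 (NConst 0) table; Slice 4 (NConst 0) table;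
              Slice 6 (NConst 0) (NConst 5)]
          0 (NConst 0) (NConst 1)))))).

(** Arrays: 0 the vector [v], 1 rewards, 2 nominal vectors, 3 the cells
    [discount; kappa; eps], 4 the maximal reward, 5 the parameters of
    [state_proc].  The components are collected in array 6 and copied to array 0
    at the end, since [v] is read for every state. *)
Definition bellman_proc (c : cmd) : cmd :=
  let table := NMul (NReg 1) (NReg 0) in
  let copy k i := RSet 5 (NConst k) (RGet 3 (NConst i)) in
  let nactions := RNat (NReg 1) in
  let kappa := RGet 3 (NConst 1) in
  let eps := RGet 3 (NConst 2) in
  let rbar := RGet 5 (NConst 3) in
  Seq
    (for_loop 2 (NMul (NReg 0) table)
       (If (BRLe (RGet 1 (NReg 2)) (RGet 4 (NConst 0)))
          Skip
          (RSet 4 (NConst 0) (RGet 1 (NReg 2)))))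
    (Seq (copy 0 0) (Seq (copy 1 1) (Seq (copy 2 2)
    (Seq (RSet 5 (NConst 3)
            (RDiv (RGet 4 (NConst 0))
               (RSub (RNat (NConst 1)) (RGet 3 (NConst 0)))))
    (Seq (RSet 5 (NConst 4)
            (RDiv (RMul eps kappa)
               (RAdd (RMul (RMul (RNat (NConst 2)) nactions) rbar)
                     (RMul nactions eps))))
    (Seq (for_loop 2 (NReg 0)
            (Call (state_proc c) [:: NReg 0; NReg 1]
               [:: Slice 0 (NConst 0) (NReg 0);
                   Slice 1 (NMul (NReg 2) table) table;
                   Slice 2 (NMul (NReg 2) table) table;
                   Slice 5 (NConst 0) (NConst 5)]
               6 (NReg 2) (NConst 1)))
         (for_loop 2 (NReg 0) (RSet 0 (NReg 2) (RGet 6 (NReg 2)))))))))).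

Definition is_table (R : realType) (S A : nat) (cells : nat -> R)
    (f : 'I_A -> 'rV[R]_S) : Prop :=
  forall (a : 'I_A) (j : 'I_S), cells (a * S + j)%N = f a 0 j.

Lemma index_in_table (S A : nat) (a : 'I_A) (j : 'I_S) :
  (a * S + j < A * S)%N.
Proof. have := ltn_ord a; have := ltn_ord j; nia. Qed.

Lemma table_index_inj (S A : nat) (a a' : 'I_A) (j j' : 'I_S) :
  (a * S + j = a' * S + j')%N -> a = a' /\ j = j'.
Proof.
move=> eq_idx; have S0 : (0 < S)%N by apply: leq_ltn_trans (ltn_ord j).
split; apply: val_inj.
  by have := congr1 (divn^~ S) eq_idx; rewrite !divnMDl // !divn_small // !addn0.
by have := congr1 (modn^~ S) eq_idx; rewrite !modnMDl !modn_small.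
Qed.

Lemma sum_ord_ltS (R : realType) (n : nat) (F : 'I_n -> R) (i : 'I_n) :
  \sum_(k < n | (k < i.+1)%N) F k = F i + \sum_(k < n | (k < i)%N) F k.
Proof.
rewrite (bigD1 i) //=; congr (_ + _); apply: eq_bigl => k.
by rewrite ltnS ltn_neqAle andbC -val_eqE.
Qed.

Lemma arrays_set_cell (R : realType) (st : store R) k i (f : nat -> R) j :
  arrays (set_block st k i 1 f) k j = if j == i then f 0%N else arrays st k j.
Proof.
rewrite /= eqxx addn1 ltnS -eqn_leq eq_sym.
by case: eqP => // ->; rewrite subnn.
Qed.

Lemma is_table_read_slice (R : realType) (S A : nat) (st : store R) sl
    (f : 'I_A -> 'rV[R]_S) :
  neval st (slice_len sl) = (A * S)%N ->
  is_table (fun j => arrays st (slice_arr sl) (neval st (slice_off sl) + j)%N) f ->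
  is_table (nth 0 (read_slice st sl)) f.
Proof.
by move=> len f_st a j; rewrite nth_read_slice ?len ?index_in_table // f_st.
Qed.

(** * Correctness and time of the bisection *)

Section Procedures.

Context (R : realType) (S A : nat).
Context (d : 'I_A -> 'rV[R]_S -> 'rV[R]_S -> R) (c : cmd) (H : nat).
Hypothesis S_gt0 : (0 < S)%N.
Hypothesis A_gt0 : (0 < A)%N.

Definition regs_ok (st : store R) : Prop := nregs st 0%N = S /\ nregs st 1%N = A.

(** The outputs [hi] are chosen before the run: each call starts in a store that
    does not depend on the progress of the loop. *)
Lemma sum_proc_reaches (pbar b : 'I_A -> 'rV[R]_S) (theta delta : R)
    (hi : 'I_A -> R) st :
  (forall a : 'I_A,
     reaches d c (load [:: S; A; val a]
         [:: vec_seq (pbar a); vec_seq (b a); [:: theta; delta]])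
       H (fun st' => arrays st' 0%N 1%N = hi a)) ->
  regs_ok st -> is_table (arrays st 0%N) pbar -> is_table (arrays st 1%N) b ->
  arrays st 2%N 0%N = theta -> arrays st 2%N 1%N = delta ->
  arrays st 4%N 0%N = 0 ->
  reaches d (sum_proc c) st (100 * A * (H + S))
    (fun st' => arrays st' 0%N 0%N = \sum_a hi a).
Proof.
move=> run regs pbarT bT theta_st delta_st acc0.
pose J i (st' : store R) :=
  [/\ regs_ok st', [/\ is_table (arrays st' 0%N) pbar,
       is_table (arrays st' 1%N) b, arrays st' 2%N 0%N = theta &
       arrays st' 2%N 1%N = delta] &
      arrays st' 4%N 0%N = \sum_(a < A | (a < i)%N) hi a].
eapply reaches_le.
  apply: reaches_seq; apply: (@reaches_for _ _ _ _ J _ _ A _ (H + 2 * S + 60)).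
  - by move=> i st' [[]].
  - by [].
  - move=> i st' lti x2 [[r0 r1] [T0 T1 p0 p1] acc].
    eapply reaches_le; first apply: reaches_seq; first apply: reaches_call.
    rewrite /= r0 r1 x2.
    rewrite (_ : read_slice st' _ = vec_seq (pbar (Ordinal lti))); last first.
      by apply: read_slice_vec => //= j; rewrite r0 x2 -(T0 (Ordinal lti)).
    rewrite (_ : read_slice st' (Slice 1 _ _) = vec_seq (b (Ordinal lti)));
      last first.
      by apply: read_slice_vec => //= j; rewrite r0 x2 -(T1 (Ordinal lti)).
    have -> : read_slice st' (Slice 2 (NConst 0) (NConst 2)) =
        [:: theta; delta] by rewrite -p0 -p1.
    apply: reaches_weaken (run (Ordinal lti)) _ (leqnn _) => st1 out.
    apply: reaches_rset; split => //; split => //.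
    by rewrite arrays_set_cell /= acc out (sum_ord_ltS _ (Ordinal lti)) addrC.
    rewrite /slice_cost /= r0; lia.
  - by split=> //; rewrite big_pred0.
  move=> st' [_ _ acc]; apply: reaches_rset; rewrite arrays_set_cell /= acc.
  by apply: eq_bigl => a; rewrite ltn_ord.
rewrite /=; nia.
Qed.


(** What the hypothesis on projections gives for one state and one accuracy; the
    real bound on the time becomes the natural number [H]. *)
Definition projection_oracle (pbar b : 'I_A -> 'rV[R]_S) (delta : R) : Prop :=
  forall (a : 'I_A) theta, 0 <= theta -> (exists i, b a 0 i <= theta) ->
  reaches d c (load [:: S; A; val a]
      [:: vec_seq (pbar a); vec_seq (b a); [:: theta; delta]])
    H (fun st => projection_accurate (d a) (pbar a) (b a) theta delta
                   (arrays st 0%N 0%N) (arrays st 0%N 1%N)).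

Lemma projection_oracle_upper pbar b delta theta :
  projection_oracle pbar b delta -> 0 <= theta ->
  (forall a, exists i, b a 0 i <= theta) ->
  exists hi : 'I_A -> R, forall a,
    projection (d a) (pbar a) (b a) theta <= hi a <=
      projection (d a) (pbar a) (b a) theta + delta /\
    reaches d c (load [:: S; A; val a]
        [:: vec_seq (pbar a); vec_seq (b a); [:: theta; delta]])
      H (fun st => arrays st 0%N 1%N = hi a).
Proof.
move=> orc theta0 feas.
have upper a : exists u,
    projection (d a) (pbar a) (b a) theta <= u <=
      projection (d a) (pbar a) (b a) theta + delta /\
    reaches d c (load [:: S; A; val a]
        [:: vec_seq (pbar a); vec_seq (b a); [:: theta; delta]])
      H (fun st => arrays st 0%N 1%N = u).
  have [st [t [run le [/andP[lo_le le_hi] gap]]]] := orc a _ theta0 (feas a).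
  exists (arrays st 0%N 1%N); split; first by rewrite le_hi /=; lra.
  by exists st, t.
exact: fin_all_exists upper.
Qed.

(** The iteration count [m] of the invariant is tied to the length of the
    interval by [hi - lo <= eps * 2 ^+ m].  Inside the loop [eps < hi - lo <= B],
    as [robust_value_ge_of_projections] requires. *)
Lemma bisect_proc_reaches (pbar b : 'I_A -> 'rV[R]_S)
    (kappa B lo0 eps delta : R) (N : nat) st :
  (forall a, deviation (d a)) -> (forall a, simplex S (pbar a)) ->
  0 < kappa -> (forall a i, 0 <= b a 0 i <= B) -> 0 < eps ->
  delta = eps * kappa / (2 * A%:R * B + A%:R * eps) ->
  projection_oracle pbar b delta ->
  B <= eps * 2 ^+ N -> 0 <= lo0 <= B ->
  (forall a, exists i, b a 0 i <= lo0) ->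
  lo0 <= robust_value d pbar b kappa ->
  regs_ok st -> is_table (arrays st 0%N) pbar -> is_table (arrays st 1%N) b ->
  [/\ arrays st 2%N 0%N = lo0, arrays st 2%N 1%N = B,
      arrays st 2%N 2%N = kappa, arrays st 2%N 3%N = eps &
      arrays st 2%N 4%N = delta] ->
  reaches d (bisect_proc c) st (250 * N.+1 * A * (H + S))
    (fun st' => `|arrays st' 0%N 0%N - robust_value d pbar b kappa| <= eps).
Proof.
move=> dev pbarS kappa0 bB eps0 deltaE orc BN /andP[lo00 lo0B] feas lo0_le.
move=> regs T0 T1 [p0 p1 p2 p3 p4].
set opt := robust_value _ _ _ _ in lo0_le *.
pose I m (st' : store R) :=
  [/\ regs_ok st', is_table (arrays st' 0%N) pbar, is_table (arrays st' 1%N) b,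
      [/\ arrays st' 2%N 2%N = kappa, arrays st' 2%N 3%N = eps &
          arrays st' 2%N 4%N = delta] &
      let lo := arrays st' 2%N 0%N in let hi := arrays st' 2%N 1%N in
      [/\ lo0 <= lo, lo <= hi, hi <= B, lo - eps / 2 <= opt <= hi &
          hi - lo <= eps * 2 ^+ m]].
eapply reaches_le.
  apply: reaches_seq.
  apply: (reaches_weaken _ _ (leqnn _)).
    apply: (@reaches_while _ _ _ _ I _ _
      (100 * A * (H + S) + 2 * A * S + 100) N).
    - move=> m st' [[r0 r1] T0' T1' [q2 q3 q4]] /=.
      move lo_eq : (arrays st' 2%N 0%N) => lo.
      move hi_eq : (arrays st' 2%N 1%N) => hi.
      move=> [lo0lo lohi hiB /andP[lo_opt opt_hi] gap].
      rewrite q3 -ltNge => wide.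
      case: m gap => [|m] gap; first by move: gap; rewrite expr0; lra.
      exists m => //; move: gap; rewrite exprS => gap.
      pose mid := (lo + hi) / 2.
      have mid_ge0 : 0 <= mid by rewrite /mid; lra.
      have feas_mid a : exists i, b a 0 i <= mid.
        by have [i bi] := feas a; exists i; rewrite /mid; lra.
      have [u uP] := projection_oracle_upper orc mid_ge0 feas_mid.
      eapply reaches_le.
        apply: reaches_seq; apply: reaches_rset.
        apply: reaches_seq; apply: reaches_rset.
        apply: reaches_seq; apply: reaches_call.
        apply: (reaches_weaken _ _ (leqnn _)).
          apply: (@sum_proc_reaches pbar b mid delta u) => //=.
          + by move=> a; have [] := uP a.
          + apply: is_table_read_slice => /=; first by rewrite r0 r1.
            exact: T0'.
          + apply: is_table_read_slice => /=; first by rewrite r0 r1.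
            exact: T1'.
          + by rewrite lo_eq hi_eq.
        move=> st1 out; apply: (@reaches_if _ _ _ _ _ _ _ _ 10).
        rewrite /= out q2; case: ifP => test;
          (eapply reaches_le; first (apply: reaches_rset; split=> //=)) => //.
        + rewrite hi_eq lo_eq -/mid.
          have lower : mid - eps / 2 <= opt.
            apply: (robust_value_ge_of_projections dev pbarS kappa0 bB A_gt0
              (delta := delta) (hi := u)) => //.
            * by lra.
            * by move=> a; have [/andP[]] := uP a.
          by rewrite lower opt_hi; split=> //; rewrite /mid; lra.
        + rewrite hi_eq lo_eq -/mid.
          have upper : opt <= mid.
            apply: (robust_value_le_of_projections dev pbarS bB A_gt0
              (hi := u)) => //.
            * by move=> a; have [/andP[]] := uP a.
            * by rewrite ltNge test.
          by rewrite upper lo_opt; split=> //; rewrite /mid; lra.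
      rewrite /slice_cost /= r0 r1; clear; lia.
    - split => //=; rewrite p0 p1; split => //.
        apply/andP; split; first by lra.
        exact: robust_value_leB dev pbarS kappa0 bB A_gt0.
      by lra.
  move=> st' [[m [_ _ _ [_ q3 _] /= [lo0lo lohi hiB /andP[lo_opt opt_hi] _]]]].
  rewrite q3 negbK => narrow.
  apply: reaches_rset; rewrite arrays_set_cell /=.
  by rewrite ler_norml; apply/andP; split; lra.
rewrite /=; clear -S_gt0 A_gt0.
have : (A <= A * S)%N by rewrite leq_pmulr.
have : (N <= N * (A * S))%N by rewrite leq_pmulr // muln_gt0 A_gt0.
nia.
Qed.

End Procedures.

(** * One component of the Bellman iterate *)

Section StateProcedure.

Context (R : realType) (S A : nat).
Context (d : 'I_A -> 'rV[R]_S -> 'rV[R]_S -> R) (c : cmd) (H : nat).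
Hypothesis S_gt0 : (0 < S)%N.
Hypothesis A_gt0 : (0 < A)%N.
Context (v : 'rV[R]_S) (r pbar : 'I_A -> 'rV[R]_S).
Context (discount kappa eps B delta : R).

Let b a := r a + discount *: v.

Definition state_inputs (st : store R) : Prop :=
  [/\ regs_ok S A st, forall j : 'I_S, arrays st 0%N j = v 0 j,
      is_table (arrays st 1%N) r, is_table (arrays st 2%N) pbar &
      [/\ arrays st 3%N 0%N = discount, arrays st 3%N 1%N = kappa,
          arrays st 3%N 2%N = eps, arrays st 3%N 3%N = B &
          arrays st 3%N 4%N = delta]].

Lemma state_proc_reaches (N : nat) st :
  (forall a, deviation (d a)) -> (forall a, simplex S (pbar a)) ->
  0 < kappa -> (forall a i, 0 <= b a 0 i <= B) -> 0 < eps ->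
  delta = eps * kappa / (2 * A%:R * B + A%:R * eps) ->
  projection_oracle d c H pbar b delta ->
  B <= eps * 2 ^+ N ->
  state_inputs st -> arrays st 6%N 0%N = 0 ->
  reaches d (state_proc c) st (1000 * N.+1 * A * (H + S))
    (fun st' => `|arrays st' 0%N 0%N - robust_value d pbar b kappa| <= eps).
Proof.
move=> dev pbarS kappa0 bB eps0 deltaE orc BN inp lo_init.
set opt := robust_value _ _ _ _.
have opt_ge a m : (forall i, m <= b a 0 i) -> m <= opt.
  by move=> mb; apply: (robust_value_ge dev pbarS kappa0 bB mb).
have bE a j : b a 0 j = r a 0 j + discount * v 0 j by rewrite !mxE.
pose filled n (st' : store R) := forall (a : 'I_A) (j : 'I_S),
  (a * S + j < n)%N -> arrays st' 4%N (a * S + j)%N = b a 0 j.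
pose J i (st' : store R) :=
  [/\ state_inputs st', filled (i * S)%N st' &
      [/\ 0 <= arrays st' 6%N 0%N, arrays st' 6%N 0%N <= opt &
          forall a : 'I_A, (a < i)%N -> exists j, b a 0 j <= arrays st' 6%N 0%N]].
eapply reaches_le.
  apply: reaches_seq; apply: (@reaches_for _ _ _ _ J _ _ A _ (300 * S)).
  - by move=> i st' [[[]]].
  - by [].
  - move=> i st' lti x2 [inp' fill [lo0 lo_opt lo_feas]].
    have [[r0 r1] vin rin pin [q0 q1 q2 q3 q4]] := inp'.
    pose ai := Ordinal lti.
    pose lo := arrays st' 6%N 0%N.
    (* Cell 0 of array 5 is always at least [min_j b ai 0 j], being one of the
       entries, and at most the entries seen so far. *)
    pose Ji i2 (st1 : store R) :=
      [/\ nregs st1 2%N = i, state_inputs st1, filled (i * S + i2)%N st1,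
          arrays st1 6%N 0%N = lo &
          (exists j, b ai 0 j <= arrays st1 5%N 0%N) /\
          (forall j : 'I_S, (j < i2)%N -> arrays st1 5%N 0%N <= b ai 0 j)].
    eapply reaches_le.
      apply: reaches_seq; apply: reaches_rset.
      apply: reaches_seq; apply: (@reaches_for _ _ _ _ Ji _ _ S _ 100).
      + by move=> i2 st1 [_ [[]]].
      + by [].
      + move=> i2 st1 lti2 x3 [x2' inp1 fill1 lo1 [m_feas m_lb]].
        have [[s0 s1] vin1 rin1 pin1 [t0 t1 t2 t3 t4]] := inp1.
        pose j2 := Ordinal lti2.
        apply: (@reaches_le _ _ _ _ _ _ (50 + 50)) => //.
        apply: reaches_seq; eapply reaches_le; first apply: reaches_rset; last by [].
        set st2 := set_block _ _ _ _ _.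
        have cell : arrays st2 4%N (i * S + i2)%N = b ai 0 j2.
          rewrite /st2 /= x2' s0 x3 leqnn addn1 ltnS leqnn /=.
          by rewrite (rin1 ai j2) t0 (vin1 j2) bE.
        have fill2 : filled (i * S + i2.+1)%N st2.
          move=> a j; rewrite addnS ltnS leq_eqVlt => /orP[/eqP e|lt].
            by rewrite e cell; have [-> ->] := @table_index_inj _ _ a ai j j2 e.
          rewrite /st2 arrays_set_cell /= x2' s0 x3 ltn_eqF //; exact: fill1.
        have inp2 : state_inputs st2 by [].
        have [y0 y2 y3] : [/\ nregs st2 0 = S, nregs st2 2 = i & nregs st2 3 = i2].
          by [].
        have [lo2 m2] : arrays st2 6 0 = lo /\
            arrays st2 5 0 = arrays st1 5 0 by [].
        rewrite -m2 in m_feas m_lb; clearbody st2.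
        eapply reaches_le; first apply: (@reaches_if _ _ _ _ _ _ _ _ 30);
          last by [].
        rewrite /= y2 y0 y3 cell; case: ifP => test.
          apply: reaches_le (_ : reaches d Skip st2 0 _) _ => //.
          apply: reaches_skip; split=> //; split=> //; split=> // j.
          rewrite ltnS leq_eqVlt => /orP[/eqP e|]; last exact: m_lb.
          by have -> : j = j2 by apply: val_inj.
        eapply reaches_le; first apply: reaches_rset; last by [].
        rewrite [reval _ _]/= y2 y0 y3 cell.
        split=> //; split=> //; rewrite arrays_set_cell /=.
        split; first by exists j2.
        move=> j; rewrite ltnS leq_eqVlt => /orP[/eqP e|lt].
          by have -> : j = j2 by apply: val_inj.
        apply: le_trans (m_lb _ lt); rewrite ltW // ltNge.
        by rewrite test.
      + split=> //.
        * by move=> a j; rewrite addn0; exact: fill.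
        * split=> //; exists (Ordinal S_gt0).
          rewrite arrays_set_cell /= x2 r0 (rin ai (Ordinal S_gt0)) q0.
          by rewrite (vin (Ordinal S_gt0)) bE.
      move=> st1 [x2' inp1 fill1 lo1 [m_feas m_lb]].
      have m_opt : arrays st1 5%N 0%N <= opt.
        by apply: (opt_ge ai) => j; apply: m_lb; exact: ltn_ord.
      apply: (@reaches_if _ _ _ _ _ _ _ _ 30); rewrite /= lo1.
      case: ifP => test.
        apply: reaches_le (_ : reaches d Skip st1 0 _) _ => //.
        apply: reaches_skip; split=> //; split=> //.
          by rewrite mulSn addnC.
        rewrite lo1; split=> // a.
        rewrite ltnS leq_eqVlt => /orP[/eqP e|lt]; last exact: lo_feas.
        have -> : a = ai by apply: val_inj.
        by have [j bj] := m_feas; exists j; apply: le_trans test.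
      eapply reaches_le; first apply: reaches_rset; last by [].
      have lt_lo : lo <= arrays st1 5%N 0%N by rewrite ltW // ltNge test.
      split=> //; split=> //; first by rewrite mulSn addnC.
      rewrite arrays_set_cell /=; split=> //; first exact: le_trans lt_lo.
      move=> a; rewrite ltnS leq_eqVlt => /orP[/eqP e|lt].
        by have -> : a = ai by apply: val_inj.
      by have [j bj] := lo_feas a lt; exists j; apply: le_trans lt_lo.
    rewrite /=; clear -S_gt0; lia.
  - split=> //; rewrite lo_init; split=> //.
    by apply: (opt_ge (Ordinal A_gt0)) => i; have /andP[] := bB (Ordinal A_gt0) i.
  move=> st' [[[r0 r1] vin rin pin [q0 q1 q2 q3 q4]] fill [lo0 lo_opt lo_feas]].
  eapply (@reaches_le _ _ _ _ _ _ _
      (50 + (50 + (50 + (50 + (400 * N.+1 * A * (H + S)))))))%N; last exact: leqnn.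
  do 4![apply: reaches_seq; eapply reaches_le; first apply: reaches_rset; last by []].
  eapply reaches_le; first apply: reaches_call.
    apply: (reaches_weaken _ _ (leqnn _)).
      apply: (@bisect_proc_reaches _ _ _ _ _ H S_gt0 A_gt0 pbar b kappa B
        (arrays st' 6%N 0%N) eps delta N) => //=.
      + rewrite lo0 /=; apply: le_trans lo_opt _.
        exact: robust_value_leB dev pbarS kappa0 bB A_gt0.
      + by move=> a; apply: lo_feas; exact: ltn_ord.
      + apply: is_table_read_slice => /=; first by rewrite r0 r1.
        exact: pin.
      + apply: is_table_read_slice => /=; first by rewrite r0 r1.
        by move=> a j; apply: fill; exact: index_in_table.
    by move=> st1 out.
  rewrite /slice_cost /= r0 r1; clear -S_gt0 A_gt0.
  have : (A * S <= N.+1 * (A * S))%N by rewrite leq_pmull.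
  have : (0 < A * S)%N by rewrite muln_gt0 A_gt0.
  nia.
rewrite /=; clear -S_gt0 A_gt0.
have : (A * S <= N.+1 * (A * S))%N by rewrite leq_pmull.
have : (0 < A * S)%N by rewrite muln_gt0 A_gt0.
nia.
Qed.

End StateProcedure.

(** * The Bellman iterate *)

(** Blocks of equal size make the position in a concatenation explicit. *)
Lemma flatten_enum_block (T : Type) (x0 : T) (n m : nat) (F : 'I_n -> seq T) :
  (forall i, size (F i) = m) ->
  size (flatten [seq F i | i <- enum 'I_n]) = (n * m)%N /\
  forall (i : 'I_n) j, (j < m)%N ->
    nth x0 (flatten [seq F i | i <- enum 'I_n]) (i * m + j)%N = nth x0 (F i) j.
Proof.
move=> sizeF; split.
  rewrite -[X in (X * m)%N]size_enum_ord.
  by elim: (enum _) => //= i s IHs; rewrite size_cat sizeF IHs mulSn.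
move=> i j ltj.
have gen (s : seq 'I_n) k : (k < size s)%N ->
    nth x0 (flatten [seq F i | i <- s]) (k * m + j)%N = nth x0 (F (nth i s k)) j.
  elim: s k => // y s IHs [_|k] /=; first by rewrite mul0n nth_cat sizeF ltj.
  rewrite ltnS => ltk; rewrite nth_cat sizeF mulSn -addnA ltnNge leq_addr /= addKn.
  exact: IHs.
by rewrite gen ?size_enum_ord // nth_ord_enum.
Qed.

Lemma size_vec_seq (R : realType) n (u : 'rV[R]_n) : size (vec_seq u) = n.
Proof. by rewrite size_map size_enum_ord. Qed.

Lemma nth_vec_seq (R : realType) n (u : 'rV[R]_n) (j : 'I_n) :
  nth 0 (vec_seq u) j = u 0 j.
Proof. by rewrite (nth_map j) ?size_enum_ord // nth_ord_enum. Qed.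

Section TableSeq.

Context (R : realType) (S A : nat) (f : 'I_S -> 'I_A -> 'rV[R]_S).

Let rows s := flatten [seq vec_seq (f s a) | a <- enum 'I_A].

Let rows_block s := flatten_enum_block 0 (fun a => size_vec_seq (f s a)).

Let table_block := flatten_enum_block 0 (fun s => (rows_block s).1 : size (rows s) = _).

Lemma size_table_seq : size (table_seq f) = (S * (A * S))%N.
Proof. exact: table_block.1. Qed.

Lemma nth_table_seq (s : 'I_S) (a : 'I_A) (j : 'I_S) :
  nth 0 (table_seq f) (s * (A * S) + (a * S + j))%N = f s a 0 j.
Proof.
rewrite [LHS]table_block.2 ?index_in_table //.
by rewrite [LHS](rows_block s).2 ?ltn_ord // nth_vec_seq.
Qed.

Lemma mem_table_seq x : x \in table_seq f -> exists s a j, x = f s a 0 j.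
Proof.
move=> /flattenP[_ /mapP[s _ ->] /flattenP[_ /mapP[a _ ->] /mapP[j _ ->]]].
by exists s, a, j.
Qed.

End TableSeq.

Section BellmanProcedure.

Context (R : realType) (S A : nat).
Context (d : 'I_A -> 'rV[R]_S -> 'rV[R]_S -> R) (c : cmd) (H : nat).
Hypothesis S_gt0 : (0 < S)%N.
Hypothesis A_gt0 : (0 < A)%N.
Context (M : rmdp R S A) (v : 'rV[R]_S) (eps : R).
Hypothesis M_valid : valid_rmdp M.
Hypothesis v_bounds : forall s, 0 <= v 0 s <= Rbar M.

Let b s a := reward M s a + discount M *: v.
Let rmax : R := \big[Num.max/0]_(s < S) \big[Num.max/0]_(a < A)
  \big[Num.max/0]_(s' < S) reward M s a 0 s'.
Let delta : R := eps * budget M / (2 * A%:R * Rbar M + A%:R * eps).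

Lemma bellman_robust_value s :
  (bellman d M v) 0 s = robust_value d (nominal M s) (b s) (budget M).
Proof. by rewrite mxE. Qed.

Lemma reward_le_rmax s a j : reward M s a 0 j <= rmax.
Proof.
apply: le_trans (le_bigmax _ _ s); apply: le_trans (le_bigmax _ _ a).
exact: (le_bigmax _ (fun j => reward M s a 0 j) j).
Qed.

Lemma rmax_least (m : R) :
  0 <= m -> (forall s a j, reward M s a 0 j <= m) -> rmax <= m.
Proof.
by move=> m0 rm; do 3![apply/bigmax_leP; split=> // ? _].
Qed.

Lemma discounted_bounds s a j : 0 <= b s a 0 j <= Rbar M.
Proof.
have [r0 /andP[l0 l1] _ _] := M_valid; have /andP[v0 vB] := v_bounds j.
rewrite /b !mxE; apply/andP; split; first by rewrite addr_ge0 // mulr_ge0 // ltW.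
have rmaxE : rmax = (1 - discount M) * Rbar M.
  by rewrite /Rbar -/rmax mulrA divff ?mul1r // gt_eqF // subr_gt0.
have := reward_le_rmax s a j; rewrite rmaxE; nra.
Qed.

Lemma bellman_proc_reaches (N : nat) :
  (forall a, deviation (d a)) -> 0 < eps ->
  (forall s, projection_oracle d c H (nominal M s) (b s) delta) ->
  Rbar M <= eps * 2 ^+ N ->
  reaches d (bellman_proc c)
    (load [:: S; A] [:: vec_seq v; table_seq (reward M); table_seq (nominal M);
                        [:: discount M; budget M; eps]])
    (1500 * N.+1 * (S * A * (H + S)))
    (fun st => forall s : 'I_S,
       `|arrays st 0%N s - (bellman d M v) 0 s| <= eps).
Proof.
move=> dev eps0 orc BN; have [r0 /andP[l0 l1] nomS kappa0] := M_valid.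
set st0 := load _ _.
pose frame (st : store R) :=
  [/\ regs_ok S A st, arrays st 0%N = arrays st0 0%N,
      arrays st 1%N = arrays st0 1%N, arrays st 2%N = arrays st0 2%N &
      arrays st 3%N = arrays st0 3%N].
pose J1 i st := [/\ frame st, 0 <= arrays st 4%N 0%N <= rmax &
  forall k, (k < i)%N -> arrays st0 1%N k <= arrays st 4%N 0%N].
pose frame2 (st : store R) := frame st /\
  [/\ arrays st 5%N 0%N = discount M, arrays st 5%N 1%N = budget M,
      arrays st 5%N 2%N = eps, arrays st 5%N 3%N = Rbar M &
      arrays st 5%N 4%N = delta].
pose J2 i st := frame2 st /\ forall s : 'I_S, (s < i)%N ->
  `|arrays st 6%N s - (bellman d M v) 0 s| <= eps.
pose J3 i st := [/\ regs_ok S A st,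
  forall s : 'I_S, `|arrays st 6%N s - (bellman d M v) 0 s| <= eps &
  forall s : 'I_S, (s < i)%N ->
    `|arrays st 0%N s - (bellman d M v) 0 s| <= eps].
eapply reaches_le.
  apply: reaches_seq.
  apply: (@reaches_for _ _ _ _ J1 _ _ (S * (A * S)) _ 30).
  - by move=> i st [[[/= -> ->]]].
  - by [].
  - move=> i st lti x2 [[[s0 s1] e0 e1 e2 e3] /andP[acc0 accM] accP].
    have cellM : arrays st 1%N i <= rmax.
      rewrite e1 -[arrays st0 1%N i]/(nth 0 (table_seq (reward M)) i).
      have /mem_table_seq[s [a [j ->]]] :
        nth 0 (table_seq (reward M)) i \in table_seq (reward M).
        by rewrite mem_nth // size_table_seq.
      exact: reward_le_rmax.
    apply: (@reaches_le _ _ _ _ _ _ (7 + 10).+1) => //.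
    apply: reaches_if; rewrite /= x2; case: ifP => test.
      apply: reaches_le (_ : reaches d Skip st 0 _) _ => //.
      apply: reaches_skip; split=> //; split=> //; first by rewrite acc0.
      move=> k; rewrite ltnS leq_eqVlt => /orP[/eqP->|]; last exact: accP.
      by rewrite -e1.
    eapply reaches_le; first apply: reaches_rset; last by [].
    have lt_acc : arrays st 4%N 0%N <= arrays st 1%N i.
      by rewrite ltW // ltNge test.
    split=> //; rewrite /J1 arrays_set_cell /= x2; split=> //.
      by rewrite cellM andbT; exact: le_trans lt_acc.
    move=> k; rewrite ltnS leq_eqVlt => /orP[/eqP->|lt]; first by rewrite e1.
    exact: le_trans (accP _ lt) lt_acc.
  - by split=> //=; rewrite lexx /=; apply: bigmax_ge_id.
  move=> st [[[s0 s1] e0 e1 e2 e3] /andP[acc0 accM] accP].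
  have acc_rmax : arrays st 4%N 0%N = rmax.
    apply/eqP; rewrite eq_le accM /=; apply: rmax_least => // s a j.
    rewrite -(nth_table_seq (reward M)); apply: accP.
    have := ltn_ord s; have := index_in_table a j; clear; nia.
  apply: reaches_seq; apply: reaches_rset.
  apply: reaches_seq; apply: reaches_rset.
  apply: reaches_seq; apply: reaches_rset.
  apply: reaches_seq; apply: reaches_rset.
  apply: reaches_seq; apply: reaches_rset.
  set st1 := set_block _ _ _ _ _.
  have st1P : frame2 st1.
    have Rbar_st : rmax / (1 - discount M) = Rbar M by rewrite mulrC.
    split; first by [].
    by split; rewrite /st1 /= ?e3 //= ?acc_rmax ?s1 Rbar_st.
  clearbody st1.
  apply: reaches_seq.
  apply: (@reaches_for _ _ _ _ J2 _ _ S _ (1300 * N.+1 * A * (H + S))).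
  - by move=> i st' [[[[]]]].
  - by [].
  - move=> i st' lti x2 [fr vals].
    have [[[t0 t1] f0 f1 f2 f3] [p0 p1 p2 p3 p4]] := fr.
    pose s := Ordinal lti.
    eapply reaches_le; first apply: reaches_call.
      apply: (reaches_weaken _ _ (leqnn _)).
        apply: (@state_proc_reaches _ _ _ d c H S_gt0 A_gt0 v (reward M s)
          (nominal M s) (discount M) (budget M) eps (Rbar M) delta N) => //=.
          exact: discounted_bounds.
        split=> //=.
        + move=> j; rewrite nth_read_slice /= ?t0 // f0.
          exact: (nth_vec_seq v).
        + apply: is_table_read_slice => /=; first by rewrite t0 t1.
          move=> a j; rewrite f1 t0 t1 x2; exact: (nth_table_seq (reward M) s).
        + apply: is_table_read_slice => /=; first by rewrite t0 t1.
          move=> a j; rewrite f2 t0 t1 x2; exact: (nth_table_seq (nominal M) s).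
      move=> st2 out; split=> //; split=> // k.
      rewrite arrays_set_cell /= x2 ltnS leq_eqVlt => /orP[/eqP e|lt].
        rewrite e eqxx; have -> : k = s by apply: val_inj.
        by rewrite bellman_robust_value.
      by rewrite ltn_eqF //; exact: vals.
    rewrite /slice_cost /= t0 t1; clear -S_gt0 A_gt0.
    have : (A * S <= N.+1 * (A * S))%N by rewrite leq_pmull.
    have : (0 < A * S)%N by rewrite muln_gt0 A_gt0.
    have : (S <= A * S)%N by rewrite leq_pmull.
    nia.
  - by split.
  move=> st' [[[[t0 t1] _ _ _ _] _] vals].
  apply: (@reaches_for _ _ _ _ J3 _ _ S _ 20).
  - by move=> i st2 [[]].
  - by [].
  - move=> i st2 lti x2 [[u0 u1] out copied].
    eapply reaches_le; first apply: reaches_rset; last by [].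
    split=> //; split=> // k; rewrite arrays_set_cell /= x2.
    rewrite ltnS leq_eqVlt => /orP[/eqP e|lt]; first by rewrite e eqxx -e.
    by rewrite ltn_eqF //; exact: copied.
  - by split=> // s; apply: vals; exact: ltn_ord.
  by move=> st2 [_ _ copied] s; apply: copied; exact: ltn_ord.
rewrite /=; clear -S_gt0 A_gt0.
have : (S * (A * S) <= N.+1 * (S * (A * S)))%N by rewrite leq_pmull.
have : (0 < A * S)%N by rewrite muln_gt0 A_gt0.
have : (S <= S * (A * S))%N by rewrite leq_pmulr // muln_gt0 A_gt0.
nia.
Qed.

End BellmanProcedure.

(** * The running time *)

(** Each unit of [log_max1 x] is worth two halvings, because
    [expR (1 / 2) <= 2]; this follows from [1 - 1 / 2 <= expR (- (1 / 2))]. *)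
Lemma halvings (R : realType) (x : R) :
  exists2 N : nat, x <= 2 ^+ N & N.+1%:R <= 4 * log_max1 x.
Proof.
pose L := log_max1 x.
have L1 : 1 <= L by rewrite /L /log_max1 le_max lexx.
exists (Num.truncn (2 * L)).+1.
  have [x0|x0] := leP x 0; first by apply: le_trans x0 _; rewrite exprn_ge0.
  have e2 : expR (1 / 2) <= 2 :> R.
    have := expR_ge1Dx (- (1 / 2) : R); rewrite expRN => h.
    have e0 := expR_gt0 (1 / 2 : R).
    have : 1 / 2 * expR (1 / 2) <= 1 :> R.
      by rewrite -[leRHS](mulVf (lt0r_neq0 e0)) ler_pM2r //; lra.
    lra.
  apply: (@le_trans _ _ (expR L)).
    rewrite -[leLHS](lnK (_ : x \is Num.pos)) ?posrE // ler_expR.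
    by rewrite /L /log_max1 le_max lexx orbT.
  set N := (Num.truncn _).+1.
  apply: (@le_trans _ _ (expR (1 / 2) ^+ N)).
    rewrite -expRM_natl ler_expR.
    have := truncnS_gt (2 * L); rewrite -/N; lra.
  by rewrite lerXn2r // nnegrE // expR_ge0.
have : (Num.truncn (2 * L))%:R <= 2 * L by rewrite truncn_le; lra.
rewrite -/L -[_.+2]addn2 natrD; lra.
Qed.

(** The bound [2 * S + 5 <= H], the length of the input of a projection, absorbs
    all the costs that are not projections. *)
Lemma bellman_time : exists2 K : nat, (0 < K)%N &
  forall S A N H : nat, (0 < S)%N -> (0 < A)%N -> (2 * S + 5 <= H)%N ->
  (2 + (S + (S * (A * S) + (S * (A * S) + 3)))
     + 1500 * N.+1 * (S * A * (H + S)) <= K * (N.+1 * (A * S * H)))%N.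
Proof.
exists (2 * 1500 + 10)%N => // S A N H S_gt0 A_gt0 leSH.
have AS : (0 < A * S)%N by rewrite muln_gt0 A_gt0.
have h1 : (A * S * H <= N.+1 * (A * S * H))%N by rewrite leq_pmull.
have h2 : (S * (A * S) <= A * S * H)%N by rewrite mulnC leq_mul2l; lia.
have h3 : (N.+1 * (S * A * (H + S)) <= 2 * (N.+1 * (A * S * H)))%N.
  have le2 : (S * A * (H + S) <= A * S * (2 * H))%N.
    by rewrite [(S * A)%N]mulnC leq_mul2l; lia.
  by have := leq_mul (leqnn N.+1) le2; lia.
have h4 : (H <= A * S * H)%N by rewrite leq_pmull.
rewrite -[(1500 * _ * _)%N]mulnA.
move: (N.+1 * (S * A * (H + S)))%N (N.+1 * (A * S * H))%N h1 h3 => X Z h1 h3.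
move: (S * (A * S))%N (A * S * H)%N h1 h2 h4 => Y W h1 h2 h4.
clear -leSH h1 h2 h3 h4; lia.
Qed.

Theorem theorem2 (R : realType) (d : deviation_family R) (h : nat -> R -> R)
    (d_deviation : forall (S A : nat) (a : 'I_A), deviation (d S A a))
    (h_projection : projection_computable d h) :
  bellman_computable d
    (fun (S A : nat) (M : rmdp R S A) (eps : R) =>
       A%:R * S%:R
       * h S (eps * budget M / (2 * A%:R * Rbar M + A%:R * eps))
       * log_max1 (Rbar M / eps)).
Proof.
have [c [C [C0 cP]]] := h_projection.
have [K K0 timeK] := bellman_time.
exists (bellman_proc c), (K%:R * 4 * C); split; first by rewrite !mulr_gt0 ?ltr0n.
move=> S A M v eps S0 A0 Mval vB eps0.
have [_ /andP[l0 l1] nomS kappa0] := Mval.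
have bB := discounted_bounds Mval vB.
have R0 : 0 <= Rbar M by have /andP[v0] := vB (Ordinal S0); exact: le_trans.
set delta := eps * _ / _.
have An0 : 0 < A%:R :> R by rewrite ltr0n.
have delta0 : 0 < delta.
  rewrite divr_gt0 ?mulr_gt0 //.
  apply: ltr_wpDl; last exact: mulr_gt0.
  by apply: mulr_ge0 => //; apply: mulr_ge0.
pose H := Num.truncn (C * h S delta).
have natH n : n%:R <= C * h S delta -> (n <= H)%N.
  by move=> le_n; rewrite truncn_ge_nat // (le_trans _ le_n).
have orc s : projection_oracle (d S A) c H (nominal M s)
    (fun a => reward M s a + discount M *: v) delta.
  move=> a theta theta0 feas.
  have [st [t [run le out]]] := cP S A a _ _ _ _ (nomS s a)
    (fun i => proj1 (andP (bB s a i))) theta0 feas delta0.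
  exists st, t; split=> //; apply: natH; apply: le_trans le.
  by rewrite ler_nat leq_addl.
have SH : (2 * S + 5 <= H)%N.
  have b0 (i : 'I_S) : 0 <= (0 : 'rV[R]_S) 0 i by rewrite mxE.
  have feas : exists i : 'I_S, (0 : 'rV[R]_S) 0 i <= 0.
    by exists (Ordinal S0); rewrite mxE.
  have [st [t [_ le _]]] := cP S A (Ordinal A0) _ _ 0 _
    (nomS (Ordinal S0) (Ordinal A0)) b0 (lexx 0) feas delta0.
  apply: natH; apply: le_trans le; rewrite ler_nat /input_size /= !size_vec_seq.
  by clear; lia.
have Hh : H%:R <= C * h S delta.
  have : (0 < H)%N by apply: leq_trans SH; rewrite addn_gt0 orbT.
  by rewrite truncn_le truncn_gt0; apply: le_trans.
have [N RN NL] := halvings (Rbar M / eps).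
have [st [t [run le out]]] := bellman_proc_reaches S0 A0 Mval vB (N := N)
  (d_deviation S A) eps0 orc ltac:(by rewrite mulrC -ler_pdivrMr).
exists st, t; split=> //.
  apply: (@le_trans _ _ ((K * (N.+1 * (A * S * H)))%:R)).
    rewrite ler_nat; apply: leq_trans (timeK S A N H S0 A0 SH).
    by rewrite leq_add // /input_size /= size_vec_seq !size_table_seq.
  rewrite !natrM.
  apply: (@le_trans _ _ (K%:R * (4 * log_max1 (Rbar M / eps) *
      (A%:R * S%:R * (C * h S delta))))); last first.
    by rewrite le_eqVlt; apply/orP; left; apply/eqP; ring.
  by rewrite ler_wpM2l // ler_pM // ?mulr_ge0 // ler_wpM2l ?mulr_ge0.
rewrite [X in X <= _]mx_normrE; apply/bigmax_leP; split; first exact: ltW.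
by move=> [i j] _ /=; rewrite ord1 !mxE; have := out j; rewrite mxE.
Qed.
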